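(* Let $f:\mathbb{R}^n\to\mathbb{R}$ have a nonempty set of global minimizers $\mathcal{X}^*$, let $x_0\in\mathbb{R}^n$, and let $S=\{x\in\mathbb{R}^n : \mathrm{dist}(x;\mathcal{X}^* )\le \mathrm{dist}(x_0;\mathcal{X}^* )\}$. Suppose $f$ is locally Lipschitz over $S$ and that there exist $M>0$ and $\gamma\in(0,1]$ such that, for all $x^*\in\mathcal{X}^*$ and $x\in S\setminus\mathcal{X}^*$, $$\|u\|\le M\quad\text{and}\quad f(x^* )\ge f(x)+\frac{1}{\gamma}\langle u,x^*-x\rangle,\qquad\forall u\in\partial^\circ f(x)$$ ($\gamma$-quasar convexity with respect to $x^*$). Suppose also that there exists $m>0$ such that $f(x)-f(x^* )\ge m\|x-x^*\|$ for all $x^*\in\mathcal{X}^*$ and $x\in S\setminus\mathcal{X}^*$ (sharpness). Then $$\bar{\mu}\ge\frac{\gamma m}{M}>0,$$ where $$\bar{\mu}=\inf_{x^*\in\mathcal{X}^*,\ x\in S\setminus\mathcal{X}^*}\ \inf_{u\in\partial^\circ f(x)\setminus\{0\}}\frac{\langle u,x-x^*\rangle}{\|u\|\,\|x-x^*\|}$$ is the inverse condition number of $f$.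
   Context: $\|\cdot\|$ is the Euclidean norm and $\langle\cdot,\cdot\rangle$ the standard inner product on $\mathbb{R}^n$; $\mathrm{dist}(x;X)=\inf_{y\in X}\|x-y\|$. ''Locally Lipschitz over $S$'' means that every point of $S$ has an open neighborhood in $\mathbb{R}^n$ on which $f$ is Lipschitz. For $x\in S$, $\partial^\circ f(x)$ denotes the Clarke (generalized) subdifferential, i.e. $\partial^\circ f(x)=\{u\in\mathbb{R}^n : \langle u,v\rangle\le f^\circ(x;v)\ \forall v\in\mathbb{R}^n\}$ with $f^\circ(x;v)=\limsup_{y\to x,\ \lambda\downarrow 0}\frac{f(y+\lambda v)-f(y)}{\lambda}$. Convention: an infimum over an empty set is $+\infty$. *)

(* Defs.v *)
From mathcomp Require Import all_boot all_order all_algebra.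
From mathcomp Require Import all_classical all_reals all_analysis.
Set Implicit Arguments.
Unset Strict Implicit.
Unset Printing Implicit Defensive.
Import Order.TTheory GRing.Theory Num.Theory.
Import numFieldNormedType.Exports.
Local Open Scope classical_set_scope.
Local Open Scope ring_scope.

(* The library norm `|x| on 'rV[R]_n is the sup norm, so the Euclidean norm is
   introduced separately; both induce the same topology, hence [open], [nbhs]
   and limits on 'rV[R]_n are those of R^n. *)
Definition inner (R : realType) (n : nat) (u v : 'rV[R]_n) : R :=
  \sum_(i < n) u 0 i * v 0 i.

Definition enorm (R : realType) (n : nat) (u : 'rV[R]_n) : R :=
  Num.sqrt (inner u u).

(* Valued in \bar R so that the infimum over the empty set is +oo. *)
Definition dist (R : realType) (n : nat) (x : 'rV[R]_n) (X : set 'rV[R]_n) :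
    \bar R :=
  ereal_inf [set (enorm (x - y))%:E | y in X].

Definition minimizers (R : realType) (n : nat) (f : 'rV[R]_n -> R) :
    set 'rV[R]_n :=
  [set x | forall y, f x <= f y].

Definition sublevel_dist (R : realType) (n : nat) (X : set 'rV[R]_n)
    (x0 : 'rV[R]_n) : set 'rV[R]_n :=
  [set x | (dist x X <= dist x0 X)%E].

Definition locally_lipschitz_over (R : realType) (n : nat)
    (S : set 'rV[R]_n) (f : 'rV[R]_n -> R) : Prop :=
  forall x, S x -> exists2 U : set 'rV[R]_n, open_nbhs x U &
    exists L : R, forall y z, U y -> U z -> `|f y - f z| <= L * enorm (y - z).

(* f°(x; v): the limsup runs over pairs (y, t) with y -> x and t -> 0, t > 0
   (y = x is allowed). *)
Definition clarke_dderiv (R : realType) (n : nat) (f : 'rV[R]_n -> R)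
    (x v : 'rV[R]_n) : \bar R :=
  limf_esup
    (fun p : 'rV[R]_n * R => ((f (p.1 + p.2 *: v) - f p.1) / p.2)%:E)
    (filter_prod (nbhs x) (at_right (0 : R))).

Definition clarke_subdiff (R : realType) (n : nat) (f : 'rV[R]_n -> R)
    (x : 'rV[R]_n) : set 'rV[R]_n :=
  [set u | forall v, ((inner u v)%:E <= clarke_dderiv f x v)%E].

Definition inv_condition_number (R : realType) (n : nat) (f : 'rV[R]_n -> R)
    (x0 : 'rV[R]_n) : \bar R :=
  let Xs := minimizers f in
  let S := sublevel_dist Xs x0 in
  ereal_inf [set
    ereal_inf [set (inner u (p.2 - p.1) / (enorm u * enorm (p.2 - p.1)))%:E
              | u in clarke_subdiff f p.2 `\ 0]
    | p in Xs `*` (S `\` Xs)].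

(* Main.v *)
Require Import Defs.
From mathcomp Require Import all_boot all_order all_algebra.
From mathcomp Require Import all_classical all_reals all_analysis.
Import Order.TTheory GRing.Theory Num.Theory.
Import numFieldNormedType.Exports.
Local Open Scope classical_set_scope.
Local Open Scope ring_scope.

(** Sharpness bounds the decrease of [f] towards a minimizer from below by
    a multiple of the distance, while quasar convexity bounds it from above by
    the directional quantity <u, x - xs>:

      m |x - xs| <= f x - f xs <= gamma^-1 <u, x - xs>.

    Hence <u, x - xs> >= gamma m |x - xs|.  Dividing by |u| |x - xs|, where
    0 < |u| <= M, bounds every cosine in the infimum from below by
    gamma m / M ([cosine_ge]).  Neither factor of the denominator vanishes
    ([enorm_gt0]): the infimum excludes u = 0, and x is not a minimizer whereas
    xs is one. *)

Lemma innerNr (R : realType) (n : nat) (u v : 'rV[R]_n) :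
  inner u (- v) = - inner u v.
Proof.
by rewrite /inner -sumrN; apply: eq_bigr => i _; rewrite mxE mulrN.
Qed.

Lemma enorm_gt0 (R : realType) (n : nat) (u : 'rV[R]_n) :
  u != 0 -> 0 < enorm u.
Proof.
move=> /rV0Pn[i ui]; rewrite /enorm sqrtr_gt0 /inner (bigD1 i) //=.
apply: ltr_pwDl; first by rewrite -expr2 exprn_even_gt0.
by apply: sumr_ge0 => j _; rewrite -expr2 sqr_ge0.
Qed.

(** Cancelling |w| leaves the bound c / |u|, which for positive [c] is smallest
    when |u| takes its largest admissible value [M]. *)
Lemma cosine_ge (R : realType) (n : nat) (u w : 'rV[R]_n) (c M : R) :
  u != 0 -> w != 0 -> 0 < c -> enorm u <= M -> c * enorm w <= inner u w ->
  c / M <= inner u w / (enorm u * enorm w).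
Proof.
move=> /enorm_gt0 u_gt0 /enorm_gt0 w_gt0 c_gt0 uM cw.
have M_gt0 : 0 < M := lt_le_trans u_gt0 uM.
apply: (@le_trans _ _ (c / enorm u)).
  by rewrite ler_pM2l // lef_pV2.
by rewrite ler_pdivlMr ?mulr_gt0 // mulrA mulfVK ?gt_eqF.
Qed.

Theorem lemma5 (R : realType) (n : nat) (f : 'rV[R]_n -> R) (x0 : 'rV[R]_n)
    (M gamma m : R)
    (Xs := minimizers f) (S := sublevel_dist Xs x0)
    (Xs_neq0 : Xs !=set0)
    (f_lip : locally_lipschitz_over S f)
    (M_gt0 : 0 < M) (gamma_gt0 : 0 < gamma) (gamma_le1 : gamma <= 1)
    (f_quasar : forall xs x, Xs xs -> (S `\` Xs) x ->
      forall u, clarke_subdiff f x u ->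
        enorm u <= M /\ f xs >= f x + gamma^-1 * inner u (xs - x))
    (m_gt0 : 0 < m)
    (f_sharp : forall xs x, Xs xs -> (S `\` Xs) x ->
      f x - f xs >= m * enorm (x - xs)) :
  ((gamma * m / M)%:E <= inv_condition_number f x0)%E /\ 0 < gamma * m / M.
Proof.
have c_gt0 : 0 < gamma * m by rewrite mulr_gt0.
split; last by rewrite divr_gt0.
apply: le_ereal_inf_tmp => _ [[xs x] /= [Xxs Sx] <-].
apply: le_ereal_inf_tmp => _ [u [Du /= u0] <-].
have [uM quasar] := f_quasar _ _ Xxs Sx _ Du.
have sharp := f_sharp _ _ Xxs Sx.
rewrite lee_fin; apply: cosine_ge => //; first exact/eqP.
  by apply/eqP => /subr0_eq xxs; case: Sx => _; apply; rewrite xxs.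
rewrite -mulrA -ler_pdivlMl // (le_trans sharp) //.
by rewrite lerBlDl -lerBlDr -mulrN -innerNr opprB.
Qed.
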